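(* Let $\varphi(a_0,a_1,a_2)=q\,\varepsilon\big(a_0(K^{-1}E\triangleright a_1)(K^{-1}F\triangleright a_2)\big)$ for $a_0,a_1,a_2\in\mathcal{O}(\mathrm{S}_q^2)$, let $\chi:\mathcal{O}(\mathrm{S}_q^2)\otimes\mathcal{O}(\mathrm{S}_q^2)\to\mathbb{C}$ be a linear functional such that $(\varphi+b_2^{\theta^{-1}*}\chi)(1,a_1,a_2)=0$ for all $a_1,a_2\in\mathcal{O}(\mathrm{S}_q^2)$, and let $\phi=\varphi+b_2^{\theta^{-1}*}\chi$ be the resulting $\theta^{-1}$-twisted cyclic 2-cocycle. The pairing of $[\phi]\in\mathrm{HC}^2_{\theta^{-1}}(\mathcal{O}(\mathrm{S}_q^2))$ with $K_0^{\mathcal{U}_q(\mathrm{su}_2)}(\mathcal{O}(\mathrm{S}_q^2))$ yields $$\langle[\phi],[P_N]\rangle=[N]_q,\qquad N\in\mathbb{Z}.$$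
   Context: Let $q>0$, $q\neq 1$, $[x]_q=\frac{q^x-q^{-x}}{q-q^{-1}}$. $\mathcal{U}_q(\mathrm{su}_2)$ is the Hopf *-algebra generated by $E,F,K,K^{-1}$ with $KK^{-1}=K^{-1}K=1$, $KE=qEK$, $FK=qKF$, $EF-FE=\frac{1}{q-q^{-1}}(K^2-K^{-2})$, $E^*=F$, $K^*=K$, $\Delta(E)=E\otimes K+K^{-1}\otimes E$, $\Delta(F)=F\otimes K+K^{-1}\otimes F$, $\Delta(K)=K\otimes K$, $\varepsilon(E)=\varepsilon(F)=\varepsilon(K-1)=0$, $S(K)=K^{-1}$, $S(E)=-qE$, $S(F)=-q^{-1}F$. $\mathcal{O}(\mathrm{SU}_q(2))$ is the coordinate Hopf *-algebra of quantum $\mathrm{SU}(2)$, generated by $a,b,c,d$ with $ab=qba$, $ac=qca$, $bd=qdb$, $cd=qdc$, $bc=cb$, $ad-da=(q-q^{-1})bc$, $ad-qbc=1$, $a^*=d$, $b^*=-qc$. It has the Peter-Weyl basis $t^l_{jk}$ ($l\in\frac12\mathbb{N}_0$, $j,k=-l,\dots,l$) of matrix elements of irreducible unitary corepresentations, with $t^{1/2}=\begin{pmatrix}a&b\\c&d\end{pmatrix}$ (indices $-\frac12,\frac12$), counit $\varepsilon(t^l_{jk})=\delta_{jk}$. The Haar state is $h(t^0_{00})=1$, $h(t^l_{jk})=0$ for $l>0$; $v^l_{jk}=[2l+1]_q^{1/2}q^jt^l_{jk}$ are orthonormal for $\langle x,y\rangle=h(x^*y)$. With $\alpha^l_j=([l-j]_q[l+j+1]_q)^{1/2}$,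 the left action (a left module *-algebra structure) is $E\triangleright v^l_{jk}=\alpha^l_kv^l_{j,k+1}$, $F\triangleright v^l_{jk}=\alpha^l_{k-1}v^l_{j,k-1}$, $K\triangleright v^l_{jk}=q^kv^l_{jk}$, and there is a commuting representation $f\mapsto\partial_f$ with $\partial_K(v^l_{jk})=q^{-j}v^l_{jk}$. The standard Podleś sphere is the left module *-subalgebra $\mathcal{O}(\mathrm{S}_q^2)=\{x:\partial_{K^2}(x)=x\}$; $\varepsilon$ also denotes the restriction of the counit to it. $\theta(y)=K^{-2}\triangleright y$ is the modular automorphism of $h$ on $\mathcal{O}(\mathrm{S}_q^2)$, so $\theta^{-1}(y)=K^2\triangleright y$. For $n\in\frac12\mathbb{Z}$, $l\in\{|n|,|n|+1,\dots\}$, let $\mathbf{t}^l_n=(t^l_{n,-l},\dots,t^l_{n,l})$ and $\mathbf{t}^{l*}_n$ its conjugate transpose (column). Let $\sigma_l(f)$ be the matrix with $f\triangleright v^l_{nk}=\sum_j\sigma_l(f)_{jk}v^l_{nj}$, $\rho_l^\circ(f)=\sigma_l(K^{-1}S(f)K)$, and $P_N:=\rho^\circ_{|N|/2}(K^{-1})\,\mathbf{t}^{|N|/2*}_{N/2}\,\mathbf{t}^{|N|/2}_{N/2}\,\rho^\circ_{|N|/2}(K)\in\mathrm{M}_{|N|+1\times|N|+1}(\mathcal{O}(\mathrm{S}_q^2))$. These (with $\rho^\circ_{|N|/2}$) are invariant projections whose classes $[P_N]$ generate the equivariant $K_0$-group $K_0^{\mathcal{U}_q(\mathrm{su}_2)}(\mathcal{O}(\mathrm{S}_q^2))$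 (taken with respect to $\theta^{-1}$). The coboundary is $(b_2^{\theta^{-1}*}\chi)(a_0,a_1,a_2)=\chi(a_0a_1,a_2)-\chi(a_0,a_1a_2)+\chi(\theta^{-1}(a_2)a_0,a_1)$. A functional $\chi$ with the stated property exists (Krähmer). A $\theta^{-1}$-twisted cyclic 2-cocycle is a trilinear $\phi$ with $\phi(a_0,a_1,a_2)=\phi(\theta^{-1}(a_2),a_0,a_1)$ and $\phi(a_0a_1,a_2,a_3)-\phi(a_0,a_1a_2,a_3)+\phi(a_0,a_1,a_2a_3)-\phi(\theta^{-1}(a_3)a_0,a_1,a_2)=0$. Its pairing with an invariant projection $P$ (with $\rho^\circ$) is $\langle[\phi],[P]\rangle=-2\,\phi(\mathrm{Tr}_{\theta^{-1}}(P\otimes P\otimes P))$, where $\mathrm{Tr}_{\theta^{-1}}(A_0\otimes A_1\otimes A_2)=\sum\rho^\circ(K^{2})_{j_3,j_0}a^0_{j_0,j_1}\otimes a^1_{j_1,j_2}\otimes a^2_{j_2,j_3}$. *)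

(* Defs.v *)
From HB Require Import structures.
From mathcomp Require Import all_boot all_order all_algebra.
From mathcomp Require Import complex reals.

Set Implicit Arguments.
Unset Strict Implicit.
Unset Printing Implicit Defensive.

Import Order.TTheory GRing.Theory Num.Theory.
Local Open Scope ring_scope.
Local Open Scope complex_scope.

(* Half-integers are doubled throughout: a spin l is given by m = 2l : nat,   *)
(* and a weight j in {-l, ..., l} by the index i : 'I_m.+1 with j = i - l.    *)

Section QNumbers.
Variables (R : realType) (q : R).

Definition qint (n : int) : R := (q ^ n - q ^ (- n)) / (q - q^-1).

(* q to the power n / 2 *)
Definition qhalf (n : int) : R := Num.sqrt q ^ n.

(* twice the weight of the index i *)
Definition wt2 (m i : nat) : int := (2 * i)%:Z - m%:Z.

(* alpha^l_j = ([l - j] [l + j + 1])^(1/2) with l = m / 2 and j = i - l *)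
Definition alpha (m i : nat) : R := Num.sqrt (qint (m%:Z - i%:Z) * qint i.+1).

End QNumbers.

Section Algebras.
Variable R : realType.
Implicit Types A B : algType R[i].

Record is_star A (star : A -> A) : Prop := {
  star_add : forall x y, star (x + y) = star x + star y;
  star_scale : forall (k : R[i]) x, star (k *: x) = k^* *: star x;
  star_mul : forall x y, star (x * y) = star y * star x;
  star_invol : involutive star }.

Definition bilinear_map (U V W : lmodType R[i]) (f : U -> V -> W) : Prop :=
  (forall u, linear (f u)) /\ (forall v, linear (f^~ v)).

(* The algebra A (x) A, given by its universal property. *)
Record tensor_square A := TensorSquare {
  tens_alg :> algType R[i];
  tens : A -> A -> tens_alg;
  tens_bilinear : bilinear_map tens;
  tens_one : tens 1 1 = 1;
  tens_mul : forall x y x' y', tens x y * tens x' y' = tens (x * x') (y * y');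
  tens_univ : forall (V : lmodType R[i]) (f : A -> A -> V), bilinear_map f ->
    exists2 g : {linear tens_alg -> V},
      (forall x y, g (tens x y) = f x y)
    & (forall g' : {linear tens_alg -> V},
         (forall x y, g' (tens x y) = f x y) -> g' =1 g) }.

Definition star_mx A (star : A -> A) (m n : nat) (M : 'M[A]_(m, n)) :
  'M[A]_(n, m) := (map_mx star M)^T.

Definition scalar_entries A (m n : nat) (M : 'M[R[i]]_(m, n)) : 'M[A]_(m, n) :=
  map_mx (fun c => c *: 1) M.

End Algebras.

Section UqSu2.
Variables (R : realType) (q : R).

Definition uq_relations (B : algType R[i]) (E F K Ki : B) : Prop :=
  [/\ K * Ki = 1 /\ Ki * K = 1,
      K * E = q%:C *: (E * K),
      F * K = q%:C *: (K * F)
    & E * F - F * E = (q - q^-1)^-1%:C *: (K ^+ 2 - Ki ^+ 2)].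

(* The Hopf *-algebra U_q(su_2): the universal algebra on the relations, with *)
(* structure maps determined by their values on the generators; the other     *)
(* Hopf *-algebra identities follow from these values.                        *)
Record Uq_su2 := UqSu2 {
  Uq_alg :> algType R[i];
  UE : Uq_alg; UF : Uq_alg; UK : Uq_alg; UKi : Uq_alg;
  Uq_rel : uq_relations UE UF UK UKi;
  Uq_univ : forall (B : algType R[i]) (e f k ki : B), uq_relations e f k ki ->
    exists2 g : {lrmorphism Uq_alg -> B},
      [/\ g UE = e, g UF = f, g UK = k & g UKi = ki]
    & (forall g' : {lrmorphism Uq_alg -> B},
         [/\ g' UE = e, g' UF = f, g' UK = k & g' UKi = ki] -> g' =1 g);
  Ustar : Uq_alg -> Uq_alg;
  Ustar_star : is_star Ustar;
  Ustar_gen : Ustar UE = UF /\ Ustar UK = UK;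
  Uten : tensor_square Uq_alg;
  UDelta : {lrmorphism Uq_alg -> Uten};
  UDelta_gen :
    [/\ UDelta UE = tens Uten UE UK + tens Uten UKi UE,
        UDelta UF = tens Uten UF UK + tens Uten UKi UF
      & UDelta UK = tens Uten UK UK];
  Ueps : {lrmorphism Uq_alg -> (R[i])^o};
  Ueps_gen : [/\ Ueps UE = 0, Ueps UF = 0 & Ueps (UK - 1) = 0];
  US : {linear Uq_alg -> Uq_alg};
  US_one : US 1 = 1;
  US_mul : forall x y, US (x * y) = US y * US x;
  US_gen : [/\ US UK = UKi, US UE = - (q%:C *: UE)
             & US UF = - (q^-1%:C *: UF)] }.

End UqSu2.

Section OSUq2.
Variables (R : realType) (q : R).

Definition suq2_relations (B : algType R[i]) (a b c d : B) : Prop :=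
  [/\ a * b = q%:C *: (b * a) /\ a * c = q%:C *: (c * a),
      b * d = q%:C *: (d * b) /\ c * d = q%:C *: (d * c),
      b * c = c * b,
      a * d - d * a = (q - q^-1)%:C *: (b * c)
    & a * d - q%:C *: (b * c) = 1].

(* the matrix (x00, x01; x10, x11) *)
Definition mx2 (T : Type) (x00 x01 x10 x11 : T) : 'M[T]_2 :=
  \matrix_(i, j) if i == 0 then (if j == 0 then x00 else x01)
                 else (if j == 0 then x10 else x11).

(* The Hopf *-algebra O(SU_q(2)). The antipode is determined by the rest of   *)
(* the structure and does not enter below.                                    *)
Record O_SUq2 := OSUq2 {
  SU_alg :> algType R[i];
  SUa : SU_alg; SUb : SU_alg; SUc : SU_alg; SUd : SU_alg;
  SU_rel : suq2_relations SUa SUb SUc SUd;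
  SU_univ : forall (B : algType R[i]) (a b c d : B), suq2_relations a b c d ->
    exists2 g : {lrmorphism SU_alg -> B},
      [/\ g SUa = a, g SUb = b, g SUc = c & g SUd = d]
    & (forall g' : {lrmorphism SU_alg -> B},
         [/\ g' SUa = a, g' SUb = b, g' SUc = c & g' SUd = d] -> g' =1 g);
  star : SU_alg -> SU_alg;
  star_star : is_star star;
  star_gen : star SUa = SUd /\ star SUb = - (q%:C *: SUc);
  SUten : tensor_square SU_alg;
  SUDelta : {lrmorphism SU_alg -> SUten};
  SUDelta_gen : forall j k,
    let u := mx2 SUa SUb SUc SUd in
    SUDelta (u j k) = \sum_i tens SUten (u j i) (u i k);
  eps : {lrmorphism SU_alg -> (R[i])^o};
  eps_gen : [/\ eps SUa = 1, eps SUb = 0, eps SUc = 0 & eps SUd = 1] }.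

End OSUq2.
Arguments star {R q _}.

Section PeterWeyl.
Variables (R : realType) (q : R) (A : O_SUq2 q).

Definition corepresentation (n : nat) (u : 'M[A]_n) : Prop :=
  forall j k, SUDelta A (u j k) = \sum_i tens (SUten A) (u j i) (u i k) /\
              eps A (u j k) = (j == k)%:R.

Definition unitary_mx (n : nat) (u : 'M[A]_n) : Prop :=
  u *m star_mx star u = 1%:M /\ star_mx star u *m u = 1%:M.

(* The coaction e_k |-> \sum_j e_j (x) u_jk has no invariant subspace besides *)
(* 0 and everything; W is invariant iff it is stable under the slices of u by *)
(* all linear functionals f. The transpose is there because subspaces are row *)
(* spaces.                                                                    *)
Definition irreducible_corep (n : nat) (u : 'M[A]_n) : Prop :=
  (0 < n)%N /\
  forall W : 'M[R[i]]_n,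
    (forall f : {linear (A : algType R[i]) -> (R[i])^o},
       stablemx W (map_mx f u : 'M[R[i]]_n)^T) ->
    W = 0 \/ row_full W.

(* t m is the matrix (t^l_jk)_{j,k} for l = m / 2. *)
Record peter_weyl (t : forall m : nat, 'M[A]_m.+1) : Prop := {
  pw_corep : forall m, corepresentation (t m);
  pw_unitary : forall m, unitary_mx (t m);
  pw_irred : forall m, irreducible_corep (t m);
  pw_half : t 1 = mx2 (SUa A) (SUb A) (SUc A) (SUd A);
  pw_span : forall x : A,
    exists (M : nat) (c : forall m : nat, 'M[R[i]]_m.+1),
      x = \sum_(m < M) \sum_j \sum_k c m j k *: t m j k;
  pw_free : forall (M : nat) (c : forall m : nat, 'M[R[i]]_m.+1),
    \sum_(m < M) \sum_j \sum_k c m j k *: t m j k = 0 ->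
    forall m, (m < M)%N -> c m = 0 }.

Definition vpw (t : forall m : nat, 'M[A]_m.+1) (m : nat) (j k : 'I_m.+1) : A :=
  (Num.sqrt (qint q m.+1) * qhalf q (wt2 m j))%:C *: t m j k.

End PeterWeyl.

Section Actions.
Variables (R : realType) (q : R) (U : Uq_su2 q) (A : O_SUq2 q).
Variable t : forall m : nat, 'M[A]_m.+1.

Record representation (act : U -> A -> A) : Prop := {
  rep_bilinear : bilinear_map act;
  rep_one : forall x, act 1 x = x;
  rep_mul : forall f g x, act (f * g) x = act f (act g x) }.

Record module_star_algebra (act : U -> A -> A) : Prop := {
  msa_rep : representation act;
  (* f |> (x y) = (f_(1) |> x) (f_(2) |> y) *)
  msa_mul : forall (x y : A) (mu : {linear (Uten U : algType R[i]) -> A}),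
    (forall g h, mu (tens (Uten U) g h) = act g x * act h y) ->
    forall f, act f (x * y) = mu (UDelta U f);
  msa_one : forall f, act f 1 = Ueps U f *: 1;
  msa_star : forall f x, star (act f x) = act (Ustar (US U f)) (star x) }.

(* The sums have at most one term; they are empty when the shifted weight     *)
(* leaves the range, where the coefficient alpha vanishes anyway.             *)
Record left_action (act : U -> A -> A) : Prop := {
  la_msa : module_star_algebra act;
  la_E : forall m (j k : 'I_m.+1), act (UE U) (vpw t j k) =
    \sum_(i < m.+1 | val i == k.+1) (alpha q m k)%:C *: vpw t j i;
  la_F : forall m (j k : 'I_m.+1), act (UF U) (vpw t j k) =
    \sum_(i < m.+1 | i.+1 == val k) (alpha q m i)%:C *: vpw t j i;
  la_K : forall m (j k : 'I_m.+1), act (UK U) (vpw t j k) =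
    (qhalf q (wt2 m k))%:C *: vpw t j k }.

Record commuting_action (act del : U -> A -> A) : Prop := {
  ca_rep : representation del;
  ca_comm : forall f g x, del f (act g x) = act g (del f x);
  ca_K : forall m (j k : 'I_m.+1), del (UK U) (vpw t j k) =
    (qhalf q (- wt2 m j))%:C *: vpw t j k }.

Definition sigma_spec (act : U -> A -> A)
    (sigma : forall m : nat, U -> 'M[R[i]]_m.+1) : Prop :=
  forall m (f : U) (n k : 'I_m.+1),
    act f (vpw t n k) = \sum_j sigma m f j k *: vpw t n j.

End Actions.

Section Podles.
Variables (R : realType) (q : R) (U : Uq_su2 q) (A : O_SUq2 q).
Variables (act del : U -> A -> A).

(* The standard Podles sphere, as a subset of O(SU_q(2)). *)
Definition podles : {pred A} := [pred x | del (UK U ^+ 2) x == x].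

Definition theta_inv (y : A) : A := act (UK U ^+ 2) y.

(* A linear functional on O(S_q^2)^{(x)2}, resp. O(S_q^2)^{(x)3}, is a        *)
(* function on A whose restriction to O(S_q^2) is bilinear, resp. trilinear;  *)
(* its values outside O(S_q^2) are irrelevant.                                *)
Definition linear_on (f : A -> R[i]) : Prop :=
  forall (k : R[i]), {in podles &, forall x y, f (k *: x + y) = k * f x + f y}.

Definition bilinear_on (chi : A -> A -> R[i]) : Prop :=
  {in podles, forall x, linear_on (chi x) /\ linear_on (chi^~ x)}.

Definition trilinear_on (phi : A -> A -> A -> R[i]) : Prop :=
  {in podles &, forall x y,
    [/\ linear_on (fun z => phi z x y), linear_on (fun z => phi x z y)
      & linear_on (fun z => phi x y z)]}.

Definition varphi (a0 a1 a2 : A) : R[i] :=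
  q%:C * eps A (a0 * act (UKi U * UE U) a1 * act (UKi U * UF U) a2).

Definition b2 (chi : A -> A -> R[i]) (a0 a1 a2 : A) : R[i] :=
  chi (a0 * a1) a2 - chi a0 (a1 * a2) + chi (theta_inv a2 * a0) a1.

Definition phi_of (chi : A -> A -> R[i]) (a0 a1 a2 : A) : R[i] :=
  varphi a0 a1 a2 + b2 chi a0 a1 a2.

Definition twisted_cyclic_2cocycle (phi : A -> A -> A -> R[i]) : Prop :=
  [/\ trilinear_on phi,
      (forall a0 a1 a2, a0 \in podles -> a1 \in podles -> a2 \in podles ->
         phi a0 a1 a2 = phi (theta_inv a2) a0 a1)
    & (forall a0 a1 a2 a3, a0 \in podles -> a1 \in podles -> a2 \in podles ->
         a3 \in podles ->
         phi (a0 * a1) a2 a3 - phi a0 (a1 * a2) a3 + phi a0 a1 (a2 * a3)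
           - phi (theta_inv a3 * a0) a1 a2 = 0)].

Variable t : forall m : nat, 'M[A]_m.+1.
Variable sigma : forall m : nat, U -> 'M[R[i]]_m.+1.

Definition rho_circ (m : nat) (f : U) : 'M[R[i]]_m.+1 :=
  sigma m (UKi U * US U f * UK U).

(* the index of the weight N / 2 = +l or -l in spin l = |N| / 2 *)
Definition row_index (N : int) : 'I_(`|N|%N.+1) :=
  if 0 <= N then ord_max else ord0.

Definition podles_proj (N : int) : 'M[A]_(`|N|%N.+1) :=
  let tN := row (row_index N) (t `|N|%N) in
  scalar_entries A (rho_circ `|N|%N (UKi U)) *m star_mx star tN *m tN
    *m scalar_entries A (rho_circ `|N|%N (UK U)).

Definition pairing (phi : A -> A -> A -> R[i]) (m : nat) (P : 'M[A]_m.+1) :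
  R[i] :=
  - 2%:R * \sum_j0 \sum_j1 \sum_j2 \sum_j3
    rho_circ m (UK U ^+ 2) j3 j0 * phi (P j0 j1) (P j1 j2) (P j2 j3).

End Podles.

(* Main.v *)
Require Import Defs.
From HB Require Import structures.
From mathcomp Require Import all_boot all_order all_algebra.
From mathcomp Require Import complex reals.
From mathcomp Require Import ring zify.
Import Order.TTheory GRing.Theory Num.Theory.
Local Open Scope ring_scope.
Local Open Scope complex_scope.

(** The 2-cocycle. At the classical point, i.e. the character eps, the vectors
    K^-1 E and K^-1 F give functionals dE, dF on O(SU_q(2)), and varphi is
    q eps (x) dE (x) dF. The coproducts of E and F give the twisted rule
    dE(xy) = dE(x) eps(y) + eps(K^-2 |> x) dE(y), and likewise for dF. On the
    sphere eps(K^2 |> x) = eps(x): on t^l_jk the operator K |> multiplies by q^k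
    and del K by q^-j, so that eps(K |> del_K x) = eps(x) everywhere
    ([eps_act_K_del_K]), while the sphere is the fixed point set of del_K^2.
    Hence dE and dF are eps-derivations there, and varphi is a twisted
    Hochschild cocycle ([varphi_hochschild]). So is a coboundary, and the
    Hochschild identity with first argument 1 turns the normalization
    phi(1, x, y) = 0 into cyclicity. All this needs the sphere to be a
    subalgebra. It is one because del_K = (f (x) id) Delta for the character
    f(x) = eps(K^-1 |> x), so that del_K is an algebra map ([del_K_slice]).

    The pairing. Let P be an idempotent over the sphere with a diagonal weight
    rho that intertwines theta^-1. The contribution of the coboundary of chi to
    phi(P, P, P) is T = sum rho_i chi(P_ij, P_ji), and summing phi(1, P, P) = 0
    gives varphi(1, P, P) + 2 T = chi(1, tr_rho P). The right-hand side vanishes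
    as soon as tr_rho P is a multiple of 1, for chi(1, 1) = 0. Therefore
    -2 phi(P, P, P) = varphi(1, P, P) - 2 varphi(P, P, P) ([trace_phi]), and chi
    has disappeared.

    The projections. Every row r of t^l, not only the two extremal ones, gives
    a projection P_jk = q^(j-k) t_rj^* t_rk over the sphere. Its weighted trace
    is annihilated by E and fixed by K, and only multiples of 1 have this
    property ([invariant_scalar]). Since eps(P) is the matrix unit at (r, r),
    the matrices dE(P), dF(P) have at most two nonzero entries each, next to
    that place, and the reduced pairing is
    (alpha^l_{r-1})^2 - (alpha^l_r)^2 = [l+r] [l-r+1] - [l-r] [l+r+1] = [2r].
    The rows r = l and r = -l with 2l = |N| give [N]. *)

Set Implicit Arguments.
Unset Strict Implicit.
Unset Printing Implicit Defensive.

(** * Linear maps, tensor squares and conjugations *)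

Section Linearity.
Variables (K : nzRingType) (V W : lmodType K).

Definition pack_linear (f : V -> W) (fL : linear f) : {linear V -> W} :=
  HB.pack f (GRing.isLinear.Build K V W _ f fL).

Lemma linear_zero (f : V -> W) : linear f -> f 0 = 0.
Proof. by move=> fL; exact: (raddf0 (pack_linear fL)). Qed.

Lemma linear_opp (f : V -> W) : linear f -> {morph f : x / - x}.
Proof. by move=> fL; exact: (raddfN (pack_linear fL)). Qed.

Lemma linear_add (f : V -> W) : linear f -> {morph f : x y / x + y}.
Proof. by move=> fL; exact: (raddfD (pack_linear fL)). Qed.

Lemma linear_scale (f : V -> W) : linear f -> scalable f.
Proof. by move=> fL k x; exact: (linearZZ (pack_linear fL)). Qed.

Lemma linear_bigsum (f : V -> W) (I : Type) (r : seq I) (P : pred I)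
    (F : I -> V) :
  linear f -> f (\sum_(i <- r | P i) F i) = \sum_(i <- r | P i) f (F i).
Proof. by move=> fL; exact: (raddf_sum (pack_linear fL)). Qed.

End Linearity.

Section Tensors.
Variables (R : realType) (B : algType R[i]) (T : tensor_square B).

(** Pure tensors span, expressed through the uniqueness half of the universal
    property. *)
Lemma tens_ext (V : lmodType R[i]) (g h : T -> V) :
  linear g -> linear h ->
  (forall x y, g (tens T x y) = h (tens T x y)) -> g =1 h.
Proof.
move=> gL hL gh.
have hB : bilinear_map (fun x y => h (tens T x y)).
  split=> [x|y] k u v /=.
    by rewrite (tens_bilinear T).1 hL.
  by rewrite (tens_bilinear T).2 hL.
have [k _ uniq] := tens_univ T hB.
move=> x; apply: etrans (uniq (pack_linear gL) gh x) _.
exact: esym (uniq (pack_linear hL) (fun _ _ => erefl) x).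
Qed.

(** The slice f (x) id by a character f is an algebra map, because it is
    multiplicative on pure tensors. *)
Lemma slice_exists (f : {lrmorphism B -> (R[i])^o}) :
  exists mu : {linear T -> B},
    [/\ forall x y, mu (tens T x y) = f x *: y,
        mu 1 = 1 & {morph mu : z z' / z * z'}].
Proof.
have fB : bilinear_map (fun x y : B => f x *: y).
  split=> [x|y] k u v /=.
    by rewrite scalerDr !scalerA mulrC.
  by rewrite linearP scalerDl scalerA.
have [mu muE _] := tens_univ T fB.
exists mu; split=> //; first by rewrite -(tens_one T) muE rmorph1 scale1r.
move=> z z'; move: z; apply: tens_ext => [k u v | k u v | x y].
- by rewrite mulrDl -scalerAl linearP.
- by rewrite linearP mulrDl -scalerAl.
move: z'; apply: tens_ext => [k u v | k u v | x' y'].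
- by rewrite mulrDr -scalerAr linearP.
- by rewrite linearP mulrDr -scalerAr.
by rewrite tens_mul !muE rmorphM -scalerAl -scalerAr scalerA.
Qed.

End Tensors.

Section Star.
Variables (R : realType) (B : algType R[i]) (s : B -> B).
Hypothesis sP : is_star s.

Lemma is_star_one : s 1 = 1.
Proof.
by rewrite -[LHS]mul1r -{1}(star_invol sP 1) -(star_mul sP) mul1r
  (star_invol sP).
Qed.

Lemma is_star_scaleR (x : R) y : s (x%:C *: y) = x%:C *: s y.
Proof.
rewrite (star_scale sP); congr (_ *: _).
by have := conjc_real x.
Qed.

Lemma is_star_zero : s 0 = 0.
Proof. by apply: (@addrI _ (s 0)); rewrite -(star_add sP) !addr0. Qed.

Lemma is_star_opp : {morph s : x / - x}.
Proof.
move=> x; apply: (@addrI _ (s x)).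
by rewrite -(star_add sP) !subrr is_star_zero.
Qed.

Lemma is_star_sum (I : Type) (r : seq I) (Q : pred I) (G : I -> B) :
  s (\sum_(i <- r | Q i) G i) = \sum_(i <- r | Q i) s (G i).
Proof. exact: (big_morph _ (star_add sP) is_star_zero). Qed.

End Star.

Lemma sum_delta (R : nzRingType) (n : nat) (Q : pred 'I_n) (G : 'I_n -> R) r :
  \sum_(i | Q i) G i * (r == i)%:R = (Q r)%:R * G r.
Proof.
rewrite big_mkcond (bigD1 r) //= eqxx mulr1 big1 ?addr0 => [|i ir].
  by case: (Q r); rewrite ?mul1r ?mul0r.
by rewrite eq_sym (negPf ir) mulr0; case: ifP.
Qed.

(** * q-numbers *)

Section QNumbers.
Variables (R : realType) (q : R).
Hypotheses (q_gt0 : 0 < q) (q_neq1 : q != 1).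

Let q_neq0 : q != 0. Proof. exact: lt0r_neq0. Qed.
Let q2_neq1 : q ^+ 2 != 1.
Proof.
by rewrite sqrf_eq1 negb_or q_neq1 gt_eqF // (lt_trans _ q_gt0) // ltrN10.
Qed.

(** This recursion has positive coefficients on both sides of q = 1, which makes
    positivity of the q-numbers immediate. *)
Lemma qintS (n : int) : qint q (n + 1) = q * qint q n + q ^ (- n).
Proof.
rewrite /qint opprD !expfzDr // expr1z -[q ^ (-1)]/(q^-1); field.
by rewrite -expr2 subr_eq0 q2_neq1 q_neq0.
Qed.

Lemma qint_ge0 (n : nat) : 0 <= qint q n.
Proof.
elim: n => [|n IHn]; first by rewrite /qint oppr0 subrr mul0r.
rewrite -addn1 PoszD qintS; apply: addr_ge0; last by rewrite ltW // exprz_gt0.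
by rewrite mulr_ge0 // ltW.
Qed.

Lemma qint_gt0 (n : nat) : 0 < qint q n.+1.
Proof.
rewrite -addn1 PoszD qintS; apply: ltr_wpDl; last by rewrite exprz_gt0.
by rewrite mulr_ge0 ?qint_ge0 // ltW.
Qed.

Lemma qint_mulB (x y : int) :
  qint q x * qint q (y + 1) - qint q y * qint q (x + 1) = qint q (x - y).
Proof.
rewrite /qint !opprD opprK !expfzDr // !expr1z -[q ^ (-1)]/(q^-1) -!invr_expz.
have := expfz_neq0 x q_neq0; have := expfz_neq0 y q_neq0.
move: (q ^ x) (q ^ y) => X Y Y0 X0; field.
by rewrite -expr2 subr_eq0 q2_neq1 q_neq0 X0.
Qed.

(** Positivity of the radicand is the point: the square root of a negative real
    is 0. *)
Lemma alpha_sqr (m i : nat) : (i <= m)%N ->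
  alpha q m i ^+ 2 = qint q (m%:Z - i%:Z) * qint q i.+1.
Proof.
move=> le_im; rewrite /alpha sqr_sqrtr // mulr_ge0 ?qint_ge0 //.
by rewrite subzn // qint_ge0.
Qed.

Lemma qhalf_gt0 n : 0 < qhalf q n.
Proof. by rewrite /qhalf exprz_gt0 // sqrtr_gt0. Qed.

Lemma qhalfN n : qhalf q (- n) = (qhalf q n)^-1.
Proof. by rewrite /qhalf invr_expz. Qed.

Lemma qhalf_wtS m i : qhalf q (wt2 m i.+1) = q * qhalf q (wt2 m i).
Proof.
rewrite /qhalf /wt2 mulnS PoszD -addrA expfzDr ?gt_eqF ?sqrtr_gt0 //.
by rewrite -exprnP sqr_sqrtr // ltW.
Qed.

Lemma qhalf_eq1 n : (qhalf q n == 1) = (n == 0).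
Proof.
have sq_gt0 : 0 < Num.sqrt q by rewrite sqrtr_gt0.
have sq_neq1 : Num.sqrt q != 1.
  apply: contraNneq q_neq1 => sq1.
  by rewrite -(sqr_sqrtr (ltW q_gt0)) sq1 expr1n.
by rewrite -(expr0z (Num.sqrt q)) /qhalf (inj_eq (ieexprIz sq_gt0 sq_neq1)).
Qed.

Lemma alpha_gt0 m k : (k < m)%N -> 0 < alpha q m k.
Proof.
move=> km; rewrite sqrtr_gt0 mulr_gt0 ?qint_gt0 //.
by rewrite subzn ?(ltnW km) // -(subnSK km) qint_gt0.
Qed.

End QNumbers.

(** * The left action on matrix elements *)

Section Pairing.
Variables (R : realType) (q : R).
Hypotheses (q_gt0 : 0 < q) (q_neq1 : q != 1).
Variables (U : Uq_su2 q) (A : O_SUq2 q).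
Variable t : forall m : nat, 'M[A]_m.+1.
Hypothesis t_pw : peter_weyl t.
Variable act : U -> A -> A.
Hypothesis act_left : left_action t act.

Notation E := (UE U).
Notation F := (UF U).
Notation K := (UK U).
Notation Ki := (UKi U).
Notation w m k := ((qhalf q (wt2 m k))%:C : R[i]).
Notation ev x := (eps A x : R[i]).

Let w_neq0 m k : w m k != 0.
Proof. by rewrite (fmorph_eq0 (real_complex R)) gt_eqF // qhalf_gt0. Qed.
Let qC_neq0 : q%:C != 0 :> R[i].
Proof. by rewrite (fmorph_eq0 (real_complex R)) gt_eqF. Qed.

Lemma act_linear f : linear (act f).
Proof. exact: (rep_bilinear (msa_rep (la_msa act_left))).1. Qed.

Lemma act_linearl x : linear (act^~ x).
Proof. exact: (rep_bilinear (msa_rep (la_msa act_left))).2. Qed.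

Lemma act_mul f g x : act (f * g) x = act f (act g x).
Proof. exact: (rep_mul (msa_rep (la_msa act_left))). Qed.

Lemma act_one x : act 1 x = x.
Proof. exact: (rep_one (msa_rep (la_msa act_left))). Qed.

Let KKi : K * Ki = 1. Proof. by case: (Uq_rel U) => [[]]. Qed.
Let KiK : Ki * K = 1. Proof. by case: (Uq_rel U) => [[]]. Qed.

Lemma act_KiK x : act Ki (act K x) = x.
Proof. by rewrite -act_mul KiK act_one. Qed.

Lemma act_KKi x : act K (act Ki x) = x.
Proof. by rewrite -act_mul KKi act_one. Qed.

(** The module algebra axiom is stated for a linear map on the tensor square;
    this form applies it to a coproduct written as a sum of pure tensors. *)
Lemma act_mulr f x y (gs : seq (U * U)) :
  UDelta U f = \sum_(g <- gs) tens (Uten U) g.1 g.2 ->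
  act f (x * y) = \sum_(g <- gs) act g.1 x * act g.2 y.
Proof.
move=> fE.
have bil : bilinear_map (fun g h => act g x * act h y).
  split=> [g|h] k u v /=.
    by rewrite act_linearl mulrDr -scalerAr.
  by rewrite act_linearl mulrDl -scalerAl.
have [mu muE _] := tens_univ (Uten U) bil.
rewrite (msa_mul (la_msa act_left) muE) fE raddf_sum.
by apply: eq_bigr => g _; exact: muE.
Qed.

Lemma act_K_mul x y : act K (x * y) = act K x * act K y.
Proof.
rewrite (@act_mulr _ _ _ [:: (K, K)]) ?big_seq1 //.
by case: (UDelta_gen U).
Qed.

Lemma act_Ki_mul x y : act Ki (x * y) = act Ki x * act Ki y.
Proof. rewrite -[in LHS](act_KKi x) -[in LHS](act_KKi y) -act_K_mul.
by rewrite act_KiK. Qed.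

Lemma act_E_mul x y : act E (x * y) = act E x * act K y + act Ki x * act E y.
Proof.
rewrite (@act_mulr _ _ _ [:: (E, K); (Ki, E)]) ?big_cons ?big_nil ?addr0 //.
by case: (UDelta_gen U).
Qed.

Lemma act_F_mul x y : act F (x * y) = act F x * act K y + act Ki x * act F y.
Proof.
rewrite (@act_mulr _ _ _ [:: (F, K); (Ki, F)]) ?big_cons ?big_nil ?addr0 //.
by case: (UDelta_gen U).
Qed.

Lemma act_unit f : act f 1 = Ueps U f *: 1.
Proof. exact: msa_one (la_msa act_left) f. Qed.

Lemma act_K_one : act K 1 = 1.
Proof.
rewrite act_unit; have [_ _] := Ueps_gen U.
by rewrite raddfB /= rmorph1 => /subr0_eq ->; rewrite scale1r.
Qed.

Lemma act_Ki_one : act Ki 1 = 1.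
Proof. by rewrite -{1}act_K_one act_KiK. Qed.

(** The antipode inverts K, and K^-1 is selfadjoint because K is. *)
Lemma star_act_K x : star (act K x) = act Ki (star x).
Proof.
rewrite (msa_star (la_msa act_left)); congr (act _ _).
have [_ K_star] := Ustar_gen U; have [-> _ _] := US_gen U.
have Ust := Ustar_star U.
have := star_mul Ust K Ki; rewrite KKi (is_star_one Ust) K_star => SK.
by rewrite -[LHS]mulr1 -KKi mulrA -SK mul1r.
Qed.

Lemma star_act_Ki x : star (act Ki x) = act K (star x).
Proof. by rewrite -[in RHS](act_KKi x) star_act_K act_KKi. Qed.

Lemma act_E_star x : act E (star x) = - (q%:C *: star (act F x)).
Proof.
have Ust := Ustar_star U; have [SE _] := Ustar_gen U.
have [_ _ UF_S] := US_gen U.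
rewrite (msa_star (la_msa act_left)) UF_S (is_star_opp Ust).
rewrite (is_star_scaleR Ust).
rewrite -SE (star_invol Ust) (linear_opp (act_linearl _)) /=.
rewrite (linear_scale (act_linearl _)) /= scalerN opprK scalerA.
by rewrite -(rmorphM (real_complex R)) mulfV ?gt_eqF // scale1r.
Qed.

Lemma act_F_star x : act F (star x) = - (q^-1%:C *: star (act E x)).
Proof.
have Ust := Ustar_star U; have [SE _] := Ustar_gen U.
have [_ UE_S _] := US_gen U.
rewrite (msa_star (la_msa act_left)) UE_S (is_star_opp Ust).
rewrite (is_star_scaleR Ust).
rewrite SE (linear_opp (act_linearl _)) /=.
rewrite (linear_scale (act_linearl _)) /= scalerN opprK scalerA.
by rewrite -(rmorphM (real_complex R)) mulVf ?gt_eqF // scale1r.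
Qed.

Let v_neq0 m (j : 'I_m.+1) :
  (Num.sqrt (qint q m.+1) * qhalf q (wt2 m j))%:C != 0 :> R[i].
Proof.
rewrite (fmorph_eq0 (real_complex R)) gt_eqF // mulr_gt0 ?qhalf_gt0 //.
by rewrite sqrtr_gt0 qint_gt0.
Qed.

(** The normalization of v^l_jk depends on l and j only, and the left action
    fixes both, so that it cancels. *)
Lemma act_K_t m j k : act K (t m j k) = w m k *: t m j k.
Proof.
apply: (scalerI (v_neq0 j)).
rewrite -(linear_scale (act_linear K)).
by rewrite (la_K act_left j k) /vpw !scalerA mulrC.
Qed.

Lemma act_E_t m j k :
  act E (t m j k) =
  \sum_(i < m.+1 | i == k.+1 :> nat) (alpha q m k)%:C *: t m j i.
Proof.
apply: (scalerI (v_neq0 j)).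
rewrite -(linear_scale (act_linear E)) (la_E act_left j k) scaler_sumr.
by apply: eq_bigr => i _; rewrite /vpw !scalerA mulrC.
Qed.

Lemma act_F_t m j k :
  act F (t m j k) =
  \sum_(i < m.+1 | i.+1 == k :> nat) (alpha q m i)%:C *: t m j i.
Proof.
apply: (scalerI (v_neq0 j)).
rewrite -(linear_scale (act_linear F)) (la_F act_left j k) scaler_sumr.
by apply: eq_bigr => i _; rewrite /vpw !scalerA mulrC.
Qed.

Lemma act_Ki_t m j k : act Ki (t m j k) = (w m k)^-1 *: t m j k.
Proof.
apply: (scalerI (w_neq0 m k)).
by rewrite -(linear_scale (act_linear Ki)) -act_K_t act_KiK scalerA
  mulfV ?scale1r.
Qed.

Lemma t_ext (V : lmodType R[i]) (f g : A -> V) :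
  linear f -> linear g ->
  (forall m j k, f (t m j k) = g (t m j k)) -> f =1 g.
Proof.
move=> fL gL fg x; have [M [c ->]] := pw_span t_pw x.
rewrite !linear_bigsum //; apply: eq_bigr => m _.
rewrite !linear_bigsum //; apply: eq_bigr => j _.
rewrite !linear_bigsum //; apply: eq_bigr => k _.
by rewrite !linear_scale // fg.
Qed.

Lemma eps_mul x y : ev (x * y) = ev x * ev y.
Proof. exact: rmorphM. Qed.

Lemma eps_scale k x : ev (k *: x) = k * ev x.
Proof. exact: linearZZ. Qed.

Lemma eps_add x y : ev (x + y) = ev x + ev y.
Proof. exact: raddfD. Qed.

Lemma eps_sum I (r : seq I) (P : pred I) (G : I -> A) :
  ev (\sum_(i <- r | P i) G i) = \sum_(i <- r | P i) ev (G i).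
Proof. exact: raddf_sum. Qed.

Lemma eps_t m j k : ev (t m j k) = (j == k)%:R.
Proof. by have [] := pw_corep t_pw j k. Qed.

Lemma t_tstar m n j : \sum_k t m n k * star (t m j k) = (n == j)%:R.
Proof.
have [/matrixP/(_ n j) + _] := pw_unitary t_pw m.
by rewrite !mxE => <-; apply: eq_bigr => k _; rewrite !mxE.
Qed.

Lemma tstar_t m n j : \sum_k star (t m k n) * t m k j = (n == j)%:R.
Proof.
have [_ /matrixP/(_ n j) +] := pw_unitary t_pw m.
by rewrite !mxE => <-; apply: eq_bigr => k _; rewrite !mxE.
Qed.

(** Unitarity identifies the conjugate of t with its inverse, and eps maps t to
    the identity matrix. *)
Lemma eps_tstar m j k : ev (star (t m j k)) = (j == k)%:R.
Proof.
have := congr1 (eps A) (t_tstar k j).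
rewrite eps_sum (eq_bigr (fun i => (k == i)%:R * ev (star (t m j i)))).
  2:{ by move=> i _; rewrite eps_mul eps_t. }
rewrite (bigD1 k) //= eqxx mul1r big1 ?addr0 => [->|i ik].
  by rewrite rmorph_nat eq_sym.
by rewrite eq_sym (negPf ik) mul0r.
Qed.

(** * The sphere as a subalgebra *)

Variable del : U -> A -> A.
Hypothesis del_comm : commuting_action t act del.
Notation sphere := (podles (U := U) del).

Lemma del_linear f : linear (del f).
Proof. exact: (rep_bilinear (ca_rep del_comm)).1. Qed.

Lemma del_K_t m j k : del K (t m j k) = (w m j)^-1 *: t m j k.
Proof.
apply: (scalerI (v_neq0 j)).
rewrite -(linear_scale (del_linear K)) (ca_K del_comm j k) /vpw !scalerA mulrC.
by rewrite qhalfN // (fmorphV (real_complex R)).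
Qed.

(** Here mu is the slice by the character eps(K^-1 |> .). This character maps t
    to a diagonal matrix, because K^-1 |> rescales the columns of t, so that its
    slice of Delta rescales the rows of t, with the weights of del K. *)
Lemma del_K_slice :
  exists2 mu : {linear SUten A -> A},
    mu 1 = 1 /\ {morph mu : z z' / z * z'} & del K =1 mu \o SUDelta A.
Proof.
pose f (x : A) : (R[i])^o := eps A (act Ki x).
have fL : linear f by move=> k x y; rewrite /f act_linear linearP.
have fM : monoid_morphism f.
  by split=> [|x y]; rewrite /f ?act_Ki_one ?rmorph1 // act_Ki_mul rmorphM.
pose g : {lrmorphism A -> (R[i])^o} := HB.pack f
  (GRing.isLinear.Build R[i] A (R[i])^o _ f fL)
  (GRing.isMonoidMorphism.Build A (R[i])^o f fM).
have [mu [muE mu1 muM]] := slice_exists (SUten A) g.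
exists mu => //; apply: t_ext => [||m j k] /=.
- exact: del_linear.
- by move=> k x y /=; rewrite !linearP.
have [-> _] := pw_corep t_pw j k.
have f_t i : f (t m j i) = (w m i)^-1 * (j == i)%:R.
  by rewrite /f act_Ki_t eps_scale eps_t.
have mu_t i : mu (tens (SUten A) (t m j i) (t m i k)) =
    ((w m i)^-1 * (j == i)%:R) *: t m i k.
  by rewrite -f_t -muE.
rewrite raddf_sum (bigD1 j) //= mu_t eqxx mulr1 del_K_t big1 ?addr0 // => i ij.
by rewrite mu_t eq_sym (negPf ij) mulr0 scale0r.
Qed.

Lemma del_K_mul x y : del K (x * y) = del K x * del K y.
Proof.
have [mu [_ muM] delE] := del_K_slice.
by rewrite !delE /= rmorphM muM.
Qed.

Lemma del_K_one : del K 1 = 1.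
Proof. by have [mu [mu1 _] ->] := del_K_slice; rewrite /= rmorph1. Qed.

Lemma in_sphere x : (x \in sphere) = (del K (del K x) == x).
Proof. by rewrite inE /= expr2 (rep_mul (ca_rep del_comm)). Qed.

Lemma sphere_one : 1 \in sphere.
Proof. by rewrite in_sphere !del_K_one. Qed.

Lemma sphere_mul x y : x \in sphere -> y \in sphere -> x * y \in sphere.
Proof. by rewrite !in_sphere !del_K_mul => /eqP-> /eqP->. Qed.

Lemma sphere_lin k x y : x \in sphere -> y \in sphere -> k *: x + y \in sphere.
Proof. by rewrite !in_sphere !del_linear => /eqP-> /eqP->. Qed.

Lemma sphere_zero : 0 \in sphere.
Proof. by rewrite in_sphere !(linear_zero (del_linear _)). Qed.

Lemma sphere_scale k x : x \in sphere -> k *: x \in sphere.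
Proof. by move=> xS; rewrite -[_ *: _]addr0 sphere_lin ?sphere_zero. Qed.

Lemma sphere_act f x : x \in sphere -> act f x \in sphere.
Proof. by rewrite !in_sphere !(ca_comm del_comm) => /eqP->. Qed.

(** On t^l_jk the two weights q^k and q^-j cancel on the diagonal j = k, where
    alone eps does not vanish. *)
Lemma eps_act_K_del_K x : ev (act K (del K x)) = ev x.
Proof.
apply: (@t_ext (R[i])^o (fun x => eps A (act K (del K x))) (eps A)).
- by move=> k y z; rewrite del_linear act_linear linearP.
- by move=> k y z; rewrite linearP.
move=> m j k; rewrite del_K_t (linear_scale (act_linear K)) act_K_t scalerA.
rewrite eps_scale eps_t; case: eqP => [->|_]; last by rewrite mulr0.
by rewrite mulVf ?mul1r.
Qed.

Lemma eps_act_K2 x : x \in sphere -> ev (act K (act K x)) = ev x.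
Proof.
rewrite in_sphere => /eqP {1}<-.
by rewrite -(ca_comm del_comm) !eps_act_K_del_K.
Qed.

Lemma eps_act_Ki2 x : x \in sphere -> ev (act Ki (act Ki x)) = ev x.
Proof.
move=> xS; rewrite -[in RHS](act_KKi x) -[in RHS](act_KKi (act Ki x)).
by rewrite eps_act_K2 // !sphere_act.
Qed.

(** * The twisted cyclic cocycle *)

(** dE and dF are the q-analogues of tangent vectors at the classical point
    eps. *)
Definition dE x : R[i] := ev (act (Ki * E) x).
Definition dF x : R[i] := ev (act (Ki * F) x).

Lemma dE_linear k x y : dE (k *: x + y) = k * dE x + dE y.
Proof. by rewrite /dE act_linear eps_add eps_scale. Qed.

Lemma dF_linear k x y : dF (k *: x + y) = k * dF x + dF y.
Proof. by rewrite /dF act_linear eps_add eps_scale. Qed.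

Lemma dE_scale k x : dE (k *: x) = k * dE x.
Proof. by rewrite /dE (linear_scale (act_linear _)) eps_scale. Qed.

Lemma dF_scale k x : dF (k *: x) = k * dF x.
Proof. by rewrite /dF (linear_scale (act_linear _)) eps_scale. Qed.

(** The extra K^-1 cancels the K in Delta(E) = E (x) K + K^-1 (x) E and leaves
    the twist K^-2 of the second term. *)
Lemma dE_mul x y : dE (x * y) = dE x * ev y + ev (act Ki (act Ki x)) * dE y.
Proof.
rewrite /dE !act_mul act_E_mul (linear_add (act_linear Ki)) !act_Ki_mul act_KiK.
by rewrite eps_add !eps_mul.
Qed.

Lemma dF_mul x y : dF (x * y) = dF x * ev y + ev (act Ki (act Ki x)) * dF y.
Proof.
rewrite /dF !act_mul act_F_mul (linear_add (act_linear Ki)) !act_Ki_mul act_KiK.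
by rewrite eps_add !eps_mul.
Qed.

Lemma dE_one : dE 1 = 0.
Proof.
have [UE0 _ _] := Ueps_gen U.
by rewrite /dE act_mul (act_unit E) UE0 scale0r
  (linear_zero (act_linear _)) raddf0.
Qed.

Lemma varphiE x y z : varphi act x y z = q%:C * (ev x * dE y * dF z).
Proof. by rewrite /varphi !eps_mul. Qed.

Notation theta := (theta_inv (U := U) act).

Lemma thetaE x : theta x = act K (act K x).
Proof. by rewrite /theta_inv expr2 act_mul. Qed.

Lemma theta_linear : linear theta.
Proof. exact: act_linear. Qed.

Lemma theta_mul x y : theta (x * y) = theta x * theta y.
Proof. by rewrite !thetaE !act_K_mul. Qed.

Lemma theta_one : theta 1 = 1.
Proof. by rewrite thetaE !act_K_one. Qed.

Lemma sphere_theta x : x \in sphere -> theta x \in sphere.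
Proof. exact: sphere_act. Qed.

Lemma eps_theta x : x \in sphere -> ev (theta x) = ev x.
Proof. by rewrite thetaE; exact: eps_act_K2. Qed.

Lemma varphi_hochschild a0 a1 a2 a3 :
  a0 \in sphere -> a1 \in sphere -> a2 \in sphere -> a3 \in sphere ->
  varphi act (a0 * a1) a2 a3 - varphi act a0 (a1 * a2) a3
    + varphi act a0 a1 (a2 * a3) - varphi act (theta a3 * a0) a1 a2 = 0.
Proof.
move=> S0 S1 S2 S3; rewrite !varphiE dE_mul dF_mul !eps_mul.
by rewrite eps_theta // !eps_act_Ki2 //; ring.
Qed.

Lemma b2_hochschild (chi : A -> A -> R[i]) a0 a1 a2 a3 :
  b2 act chi (a0 * a1) a2 a3 - b2 act chi a0 (a1 * a2) a3
    + b2 act chi a0 a1 (a2 * a3) - b2 act chi (theta a3 * a0) a1 a2 = 0.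
Proof. by rewrite /b2 theta_mul !mulrA; ring. Qed.

Variable chi : A -> A -> R[i].
Hypothesis chi_bilin : bilinear_on (U := U) del chi.
Hypothesis chi_phi : forall a1 a2 : A, a1 \in sphere -> a2 \in sphere ->
  phi_of act chi 1 a1 a2 = 0.
Notation phi := (phi_of act chi).

Lemma chi_linl x k : {in sphere & , forall y z, x \in sphere ->
  chi (k *: y + z) x = k * chi y x + chi z x}.
Proof. by move=> y z yS zS xS; exact: ((chi_bilin xS).2 k y z yS zS). Qed.

Lemma chi_linr x k : {in sphere & , forall y z, x \in sphere ->
  chi x (k *: y + z) = k * chi x y + chi x z}.
Proof. by move=> y z yS zS xS; exact: ((chi_bilin xS).1 k y z yS zS). Qed.

Lemma phi_trilinear : trilinear_on (U := U) del phi.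
Proof.
have linl k (u v z : A) : (k *: u + v) * z = k *: (u * z) + v * z.
  by rewrite mulrDl scalerAl.
have linr k (u v z : A) : z * (k *: u + v) = k *: (z * u) + z * v.
  by rewrite mulrDr scalerAr.
move=> x y xS yS; split=> k u v uS vS; rewrite /phi_of !varphiE /b2.
- rewrite eps_add eps_scale linl linr.
  by rewrite !chi_linl ?sphere_mul ?sphere_theta //; ring.
- rewrite dE_linear linl linr.
  by rewrite chi_linl ?chi_linr ?sphere_mul ?sphere_theta //; ring.
rewrite dF_linear theta_linear linl linr.
by rewrite chi_linl ?chi_linr ?sphere_mul ?sphere_theta //; ring.
Qed.

Lemma phi_hochschild a0 a1 a2 a3 :
  a0 \in sphere -> a1 \in sphere -> a2 \in sphere -> a3 \in sphere ->
  phi (a0 * a1) a2 a3 - phi a0 (a1 * a2) a3 + phi a0 a1 (a2 * a3)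
    - phi (theta a3 * a0) a1 a2 = 0.
Proof.
move=> S0 S1 S2 S3; rewrite /phi_of.
have := varphi_hochschild S0 S1 S2 S3; have := b2_hochschild chi a0 a1 a2 a3.
move: (b2 act chi) (varphi act) => b p hb hp.
by rewrite -[0]addr0 -{1}hp -hb; ring.
Qed.

(** Cyclicity is the Hochschild identity at (1, a0, a1, a2), whose two middle
    terms vanish by normalization. *)
Lemma phi_cocycle : twisted_cyclic_2cocycle act del phi.
Proof.
split; [exact: phi_trilinear | | exact: phi_hochschild].
move=> a0 a1 a2 S0 S1 S2; have := phi_hochschild sphere_one S0 S1 S2.
rewrite mul1r mulr1 !chi_phi ?sphere_mul // subr0 addr0 => /eqP.
by rewrite subr_eq0 => /eqP.
Qed.

(** * Eliminating the coboundary from the pairing *)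

Lemma chi_one_one : chi 1 1 = 0.
Proof.
have := chi_phi sphere_one sphere_one.
by rewrite /phi_of varphiE dE_one /b2 theta_one !mulr1 mulr0 mul0r mulr0
  subrr !add0r.
Qed.

Lemma chi_scalel k x y : x \in sphere -> y \in sphere ->
  chi (k *: x) y = k * chi x y.
Proof.
move=> xS yS; have chi0 : chi 0 y = 0.
  have := chi_linl 1 sphere_zero sphere_zero yS.
  by rewrite scale1r mul1r addr0 => /eqP; rewrite addrC -subr_eq subrr => /eqP.
by rewrite -[k *: x]addr0 chi_linl ?sphere_zero // chi0 addr0.
Qed.

Lemma chi_scaler k x y : x \in sphere -> y \in sphere ->
  chi x (k *: y) = k * chi x y.
Proof.
move=> xS yS; have chi0 : chi x 0 = 0.
  have := chi_linr 1 sphere_zero sphere_zero xS.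
  by rewrite scale1r mul1r addr0 => /eqP; rewrite addrC -subr_eq subrr => /eqP.
by rewrite -[k *: y]addr0 chi_linr ?sphere_zero // chi0 addr0.
Qed.

Lemma chi_suml (I : finType) (G : I -> A) y :
  (forall i, G i \in sphere) -> y \in sphere ->
  chi (\sum_i G i) y = \sum_i chi (G i) y.
Proof.
move=> GS yS; pose Q x v := x \in sphere /\ chi x y = v.
suff [] : Q (\sum_i G i) (\sum_i chi (G i) y) by [].
elim/big_rec2: _ => [|i v x _ [xS <-]].
  split; first exact: sphere_zero.
  by rewrite -(scale0r 1) chi_scalel ?sphere_one // mul0r.
rewrite -[G i]scale1r; split; rewrite ?sphere_lin //.
by rewrite chi_linl // scale1r mul1r.
Qed.

Lemma chi_sumr (I : finType) (G : I -> A) x :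
  (forall i, G i \in sphere) -> x \in sphere ->
  chi x (\sum_i G i) = \sum_i chi x (G i).
Proof.
move=> GS xS; pose Q y v := y \in sphere /\ chi x y = v.
suff [] : Q (\sum_i G i) (\sum_i chi x (G i)) by [].
elim/big_rec2: _ => [|i v y _ [yS <-]].
  split; first exact: sphere_zero.
  by rewrite -(scale0r 1) chi_scaler ?sphere_one // mul0r.
rewrite -[G i]scale1r; split; rewrite ?sphere_lin //.
by rewrite chi_linr // scale1r mul1r.
Qed.

Section TwistedTrace.
Variables (n : nat) (P : 'M[A]_n) (rho : 'I_n -> R[i]) (c : R[i]).
Hypothesis P_sphere : forall i j, P i j \in sphere.
Hypothesis P_idem : P *m P = P.
Hypothesis P_theta : forall i j, rho j *: theta (P i j) = rho i *: P i j.
Hypothesis P_trace : \sum_i rho i *: P i i = c *: 1.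

(* the pairing of the cochain chi with P *)
Let T := \sum_i \sum_j rho i * chi (P i j) (P j i).

Let PP i k : \sum_j P i j * P j k = P i k.
Proof. by rewrite -[in RHS]P_idem mxE. Qed.

(** Twisting by theta^-1 moves the weight rho along the entry P_ij. *)
Lemma chi_theta_shift i j x y : x \in sphere -> y \in sphere ->
  rho j * chi (theta (P i j) * x) y = rho i * chi (P i j * x) y.
Proof.
move=> xS yS; rewrite -!chi_scalel ?sphere_mul ?sphere_theta //.
by rewrite !scalerAl P_theta.
Qed.

(** Each of the three terms of the coboundary contracts to T, the third one
    after a cyclic relabelling, so that their alternating sum is T. *)
Lemma b2_trace :
  \sum_i \sum_j \sum_k rho i * b2 act chi (P i j) (P j k) (P k i) = T.
Proof.
pose S (G : 'I_n -> 'I_n -> 'I_n -> R[i]) :=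
  \sum_i \sum_j \sum_k rho i * G i j k.
have first : S (fun i j k => chi (P i j * P j k) (P k i)) = T.
  apply: eq_bigr => i _; rewrite exchange_big; apply: eq_bigr => k _.
  by rewrite -mulr_sumr -chi_suml ?PP // => j; rewrite sphere_mul.
have second : S (fun i j k => chi (P i j) (P j k * P k i)) = T.
  apply: eq_bigr => i _; apply: eq_bigr => j _.
  by rewrite -mulr_sumr -chi_sumr ?PP // => k; rewrite sphere_mul.
have third : S (fun i j k => chi (theta (P k i) * P i j) (P j k)) = T.
  rewrite /S; under eq_bigr do rewrite exchange_big /=.
  rewrite exchange_big /= -first; apply: eq_bigr => k _; apply: eq_bigr => i _.
  by apply: eq_bigr => j _; rewrite chi_theta_shift.
rewrite -[RHS](subrK T) -[X in X - _]first -[X in _ - X]second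
  -[X in _ + X]third.
rewrite -sumrB -big_split; apply: eq_bigr => i _.
rewrite -sumrB -big_split; apply: eq_bigr => j _.
rewrite -sumrB -big_split; apply: eq_bigr => k _.
by rewrite /= /b2 mulrDr mulrBr.
Qed.

(** This sums phi(1, P_ij, P_ji) = 0. The middle term of the coboundary is
    chi(1, .) at the weighted trace of P, which is a multiple of 1. *)
Lemma trace_normalized :
  \sum_i \sum_j rho i * varphi act 1 (P i j) (P j i) + T *+ 2 = 0.
Proof.
have chi1 : \sum_i \sum_j rho i * chi 1 (P i j * P j i) = 0.
  transitivity (chi 1 (c *: 1)); last first.
    by rewrite chi_scaler ?sphere_one // chi_one_one mulr0.
  rewrite -P_trace chi_sumr ?sphere_one // => [|i]; last exact: sphere_scale.
  apply: eq_bigr => i _; rewrite chi_scaler ?sphere_one // -mulr_sumr.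
  by rewrite -chi_sumr ?sphere_one ?PP // => j; rewrite sphere_mul.
have third : \sum_i \sum_j rho i * chi (theta (P j i)) (P i j) = T.
  rewrite exchange_big; apply: eq_bigr => j _; apply: eq_bigr => i _ /=.
  by rewrite -[theta _]mulr1 chi_theta_shift ?sphere_one // mulr1.
have phi1 : \sum_i \sum_j rho i * phi 1 (P i j) (P j i) = 0.
  by rewrite big1 // => i _; rewrite big1 // => j _; rewrite chi_phi ?mulr0.
rewrite -[RHS]phi1 mulr2n -[X in _ + (X + _)](subr0 T).
rewrite -[X in _ + (_ - X + _)]chi1.
rewrite -[X in _ + (_ + X)]third /T -sumrB -!big_split; apply: eq_bigr => i _.
rewrite -sumrB -!big_split; apply: eq_bigr => j _.
by rewrite /= /phi_of /b2 mul1r mulr1 !mulrDr mulrN.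
Qed.

(** By [b2_trace] and [trace_normalized], with T eliminated. *)
Lemma trace_phi :
  - 2%:R * \sum_i \sum_j \sum_k rho i * phi (P i j) (P j k) (P k i)
  = \sum_i \sum_j rho i * varphi act 1 (P i j) (P j i)
    - 2%:R * \sum_i \sum_j \sum_k rho i * varphi act (P i j) (P j k) (P k i).
Proof.
have -> : \sum_i \sum_j \sum_k rho i * phi (P i j) (P j k) (P k i) =
    \sum_i \sum_j \sum_k rho i * varphi act (P i j) (P j k) (P k i) + T.
  rewrite -b2_trace -big_split; apply: eq_bigr => i _.
  rewrite -big_split; apply: eq_bigr => j _.
  rewrite -big_split; apply: eq_bigr => k _.
  by rewrite /= /phi_of mulrDr.
have /eqP := trace_normalized; rewrite addr_eq0 => /eqP ->.
ring.
Qed.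

End TwistedTrace.

(** * Invariant elements *)

(** Freeness of the Peter-Weyl basis for coefficients given as functions. *)
Lemma t_coef_eq0 (M : nat) (c : forall m : nat, 'I_m.+1 -> 'I_m.+1 -> R[i]) :
  \sum_(m < M) \sum_j \sum_k c m j k *: t m j k = 0 ->
  forall m, (m < M)%N -> forall j k, c m j k = 0.
Proof.
move=> c0 m mM j k.
have /matrixP/(_ j k) : \matrix_(j, k) c m j k = 0.
  apply: (pw_free t_pw (c := fun m => \matrix_(j, k) c m j k) _ mM).
  rewrite -[RHS]c0; apply: eq_bigr => m' _; apply: eq_bigr => j' _.
  by apply: eq_bigr => k' _; rewrite mxE.
by rewrite !mxE.
Qed.

Let w_eq1 m k : (w m k == 1) = (2 * k == m)%N.
Proof.
rewrite -(rmorph1 (real_complex R)) (inj_eq (fmorph_inj (real_complex R))).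
by rewrite qhalf_eq1 // /wt2 subr_eq0.
Qed.

Let alpha_neq0 m k : (k < m)%N -> (alpha q m k)%:C != 0 :> R[i].
Proof.
by move=> km; rewrite (fmorph_eq0 (real_complex R)) gt_eqF // alpha_gt0.
Qed.

(** K leaves only the columns of weight 0, and E is injective on every column
    but the last one. The last column has weight l, so that l = 0. *)
Lemma invariant_t0 z : act K z = z -> act E z = 0 -> z = ev z *: t 0 ord0 ord0.
Proof.
have [M [c ->]] := pw_span t_pw z; set x := \sum_(m < M) _ => Kx Ex.
have K0 : forall m, (m < M)%N -> forall j k, c m j k * (w m k - 1) = 0.
  apply: t_coef_eq0; rewrite -[RHS](subrr x) -{1}Kx /x.
  rewrite (linear_bigsum _ _ _ (act_linear K)) -sumrB; apply: eq_bigr => m _.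
  rewrite (linear_bigsum _ _ _ (act_linear K)) -sumrB; apply: eq_bigr => j _.
  rewrite (linear_bigsum _ _ _ (act_linear K)) -sumrB; apply: eq_bigr => k _.
  rewrite (linear_scale (act_linear K)) act_K_t scalerA -scalerBl.
  by rewrite mulrBr mulr1.
have E0 : forall m, (m < M)%N -> forall (j i : 'I_m.+1),
    \sum_(k < m.+1 | i == k.+1 :> nat) c m j k * (alpha q m k)%:C = 0.
  apply: (@t_coef_eq0 M (fun m j i =>
    \sum_(k < m.+1 | i == k.+1 :> nat) c m j k * (alpha q m k)%:C)).
  rewrite -[RHS]Ex /x.
  rewrite (linear_bigsum _ _ _ (act_linear E)); apply: eq_bigr => m _.
  rewrite (linear_bigsum _ _ _ (act_linear E)); apply: eq_bigr => j _.
  under eq_bigr do rewrite scaler_suml big_mkcond /=.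
  rewrite exchange_big (linear_bigsum _ _ _ (act_linear E)).
  apply: eq_bigr => k _; rewrite -big_mkcond (linear_scale (act_linear E)).
  by rewrite act_E_t scaler_sumr; apply: eq_bigr => i _; rewrite scalerA.
have c0 m (j k : 'I_m.+1) : (0 < m < M)%N -> c m j k = 0.
  case/andP=> m_gt0 mM; have [wk1|wk1] := eqVneq (w m k) 1; last first.
    have /eqP := K0 m mM j k.
    by rewrite mulf_eq0 subr_eq0 (negPf wk1) orbF => /eqP.
  have km : (k < m)%N by move/eqP: wk1; rewrite w_eq1; lia.
  have := E0 m mM j (inord k.+1); rewrite (bigD1 k) /=; last by rewrite inordK.
  rewrite big1 ?addr0 => [/eqP|i /andP[]].
    by rewrite mulf_eq0 (negPf (alpha_neq0 km)) orbF => /eqP.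
  by rewrite inordK // eqSS => /eqP ki; rewrite -(inj_eq val_inj) /= ki eqxx.
suff [k ->] : exists k, x = k *: t 0 ord0 ord0.
  by rewrite eps_scale eps_t eqxx mulr1.
rewrite /x; case: (M) c0 => [|M'] c0.
  by exists 0; rewrite big_ord0 scale0r.
exists (c 0%N ord0 ord0); rewrite big_ord_recl !big_ord1 big1 ?addr0 // => m _.
rewrite big1 // => j _; rewrite big1 // => k _.
by rewrite c0 ?scale0r //= ltnS.
Qed.

(** [invariant_t0] applies to 1 as well, and identifies t^0 with 1. *)
Lemma invariant_scalar z : act K z = z -> act E z = 0 -> z = ev z *: 1.
Proof.
move=> Kz Ez; have E1 : act E 1 = 0.
  by have [UE0 _ _] := Ueps_gen U; rewrite act_unit UE0 scale0r.
rewrite {1}(invariant_t0 Kz Ez) [in RHS](invariant_t0 act_K_one E1).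
by rewrite [eps A 1]rmorph1 scale1r.
Qed.

(** * The projection of a row *)

Section Row.
Variables (m : nat) (r : 'I_m.+1).
Notation a k := ((alpha q m k)%:C : R[i]).

Lemma dE_t k : dE (t m r k) = (r == k.+1 :> nat)%:R * (a k / w m r).
Proof.
rewrite /dE act_mul act_E_t (linear_bigsum _ _ _ (act_linear Ki)) eps_sum.
rewrite -(sum_delta (fun i : 'I_m.+1 => i == k.+1 :> nat)
  (fun i => a k / w m i)).
apply: eq_bigr => i _.
by rewrite (linear_scale (act_linear Ki)) act_Ki_t !eps_scale eps_t mulrA.
Qed.

Lemma dF_t k : dF (t m r k) = (r.+1 == k :> nat)%:R * (a r / w m r).
Proof.
rewrite /dF act_mul act_F_t (linear_bigsum _ _ _ (act_linear Ki)) eps_sum.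
rewrite -(sum_delta (fun i : 'I_m.+1 => i.+1 == k :> nat)
  (fun i => a i / w m i)).
apply: eq_bigr => i _.
by rewrite (linear_scale (act_linear Ki)) act_Ki_t !eps_scale eps_t mulrA.
Qed.

Lemma act_K_tstar k : act K (star (t m r k)) = (w m k)^-1 *: star (t m r k).
Proof.
rewrite -star_act_Ki act_Ki_t -(fmorphV (real_complex R)).
by rewrite (is_star_scaleR (star_star A)).
Qed.

Lemma act_Ki_tstar k : act Ki (star (t m r k)) = w m k *: star (t m r k).
Proof. by rewrite -star_act_K act_K_t (is_star_scaleR (star_star A)). Qed.

Lemma dE_tstar k :
  dE (star (t m r k)) = - (q%:C * ((r.+1 == k :> nat)%:R * (a r * w m r))).
Proof.
rewrite /dE act_mul act_E_star (linear_opp (act_linear Ki)).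
rewrite (linear_scale (act_linear Ki)) raddfN /= eps_scale act_F_t.
rewrite (is_star_sum (star_star A)).
rewrite (linear_bigsum _ _ _ (act_linear Ki)) eps_sum.
rewrite -(sum_delta (fun i : 'I_m.+1 => i.+1 == k :> nat)
  (fun i => a i * w m i)).
congr (- (_ * _)); apply: eq_bigr => i _.
rewrite (is_star_scaleR (star_star A)) (linear_scale (act_linear Ki)).
by rewrite act_Ki_tstar !eps_scale eps_tstar mulrA.
Qed.

Lemma dF_tstar k :
  dF (star (t m r k)) = - (q^-1%:C * ((r == k.+1 :> nat)%:R * (a k * w m r))).
Proof.
rewrite /dF act_mul act_F_star (linear_opp (act_linear Ki)).
rewrite (linear_scale (act_linear Ki)) raddfN /= eps_scale act_E_t.
rewrite (is_star_sum (star_star A)).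
rewrite (linear_bigsum _ _ _ (act_linear Ki)) eps_sum.
rewrite -(sum_delta (fun i : 'I_m.+1 => i == k.+1 :> nat)
  (fun i => a k * w m i)).
congr (- (_ * _)); apply: eq_bigr => i _.
rewrite (is_star_scaleR (star_star A)) (linear_scale (act_linear Ki)).
by rewrite act_Ki_tstar !eps_scale eps_tstar mulrA.
Qed.

Lemma w_succ (i j : nat) : j = i.+1 -> w m j = q%:C * w m i.
Proof. by move=> ->; rewrite qhalf_wtS // rmorphM. Qed.

(** The conjugate of t inverts t, and del_K is multiplicative, so that the row
    weight of t_rk is inverted too. *)
Lemma del_K_tstar k : del K (star (t m r k)) = w m r *: star (t m r k).
Proof.
have tX n :
    \sum_i t m n i * del K (star (t m r i)) = ((n == r)%:R * w m r) *: 1.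
  apply: (scalerI (invr_neq0 (w_neq0 m n))); rewrite scaler_sumr.
  transitivity (del K (\sum_i t m n i * star (t m r i))).
    rewrite (linear_bigsum _ _ _ (del_linear K)); apply: eq_bigr => i _.
    by rewrite del_K_mul del_K_t scalerAl.
  rewrite t_tstar scalerA; have [->|_] := eqVneq n r.
    by rewrite del_K_one mul1r mulVf ?scale1r.
  by rewrite (linear_zero (del_linear K)) mul0r mulr0 scale0r.
transitivity (\sum_i (k == i)%:R * del K (star (t m r i))).
  rewrite (bigD1 k) //= eqxx mul1r big1 ?addr0 // => i ik.
  by rewrite eq_sym (negPf ik) mul0r.
under eq_bigr do rewrite -tstar_t mulr_suml.
rewrite exchange_big (bigD1 r) //= [X in _ + X]big1 ?addr0 => [|n nr].
  under eq_bigr do rewrite -mulrA.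
  by rewrite -mulr_sumr tX eqxx mul1r -scalerAr mulr1.
under eq_bigr do rewrite -mulrA.
by rewrite -mulr_sumr tX (negPf nr) mul0r scale0r mulr0.
Qed.

(** The matrix rho(K^-1) t_r^* t_r rho(K) for an arbitrary row t_r, where
    w j = q^j for the weight j. *)
Definition row_proj : 'M[A]_m.+1 :=
  \matrix_(j, k) ((w m j / w m k) *: (star (t m r j) * t m r k)).

Lemma row_proj_sphere j k : row_proj j k \in sphere.
Proof.
rewrite mxE sphere_scale // in_sphere !del_K_mul del_K_tstar del_K_t.
rewrite (linear_scale (del_linear K)) del_K_tstar (linear_scale (del_linear K)).
rewrite del_K_t !scalerA -scalerAl -scalerAr scalerA.
suff -> : w m r * w m r * ((w m r)^-1 / w m r) = 1 by rewrite scale1r.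
by field; exact: w_neq0.
Qed.

Lemma row_proj_idem : row_proj *m row_proj = row_proj.
Proof.
apply/matrixP => i k; rewrite !mxE.
transitivity (\sum_j (w m i / w m k) *:
    (star (t m r i) * (t m r j * star (t m r j)) * t m r k)).
  apply: eq_bigr => j _; rewrite !mxE -scalerAl -scalerAr scalerA !mulrA.
  by congr (_ *: _); field; rewrite !w_neq0.
by rewrite -scaler_sumr -mulr_suml -mulr_sumr t_tstar eqxx mulr1.
Qed.

Lemma row_proj_theta (j k : 'I_m.+1) :
  (w m k ^- 2) *: theta (row_proj j k) = (w m j ^- 2) *: row_proj j k.
Proof.
rewrite mxE (linear_scale theta_linear) theta_mul !thetaE.
rewrite act_K_tstar (linear_scale (act_linear K)) act_K_tstar act_K_t.
rewrite (linear_scale (act_linear K)) act_K_t !scalerA.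
rewrite -scalerAl -scalerAr !scalerA.
by congr (_ *: _); field; rewrite !w_neq0.
Qed.

Let z := \sum_(i : 'I_m.+1) (w m i ^- 2) *: row_proj i i.

Let K_z : act K z = z.
Proof.
rewrite (linear_bigsum _ _ _ (act_linear K)); apply: eq_bigr => i _.
rewrite !mxE !(linear_scale (act_linear K)) act_K_mul act_K_tstar act_K_t.
rewrite -scalerAl -scalerAr !scalerA.
by congr (_ *: _); field; rewrite !w_neq0.
Qed.

(* E lowers the index of the left factor or raises that of the right one. Both
   yield multiples of t_ri^* t_r(i+1), whose coefficients cancel because the
   weights satisfy w (i+1) = q w i. *)
Let E_z : act E z = 0.
Proof.
rewrite (linear_bigsum _ _ _ (act_linear E)).
pose x (i k : 'I_m.+1) := ((w m i)^-1 * a i) *: (star (t m r i) * t m r k).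
transitivity (\sum_(i < m.+1) (- (\sum_(l < m.+1 | i == l.+1 :> nat) x l i)
                      + \sum_(l < m.+1 | l == i.+1 :> nat) x i l)).
  apply: eq_bigr => i _.
  rewrite mxE !(linear_scale (act_linear E)) act_E_mul act_E_star.
  rewrite act_F_t act_E_t (is_star_sum (star_star A)) act_K_t act_Ki_tstar.
  rewrite mulNr !scalerDr !scalerN -!scalerAl -!scalerAr !scalerA.
  rewrite mulr_suml mulr_sumr !scaler_sumr.
  congr (- _ + _).
    rewrite (eq_bigl (fun l : 'I_m.+1 => i == l.+1 :> nat)) => [|l]; last first.
      exact: eq_sym.
    apply: eq_bigr => l /eqP il; rewrite /x (is_star_scaleR (star_star A)).
    rewrite -scalerAl !scalerA (w_succ il); congr (_ *: _).
    by field; rewrite !w_neq0.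
  apply: eq_bigr => l _; rewrite /x -scalerAr scalerA; congr (_ *: _).
  by field; rewrite !w_neq0.
rewrite big_split sumrN /= (exchange_big_dep xpredT) //=.
by rewrite addrC subrr.
Qed.

Lemma row_proj_trace : exists c, z = c *: 1.
Proof. by exists (ev z); exact: invariant_scalar K_z E_z. Qed.

Lemma eps_row_proj j k : ev (row_proj j k) = (j == r)%:R * (k == r)%:R.
Proof.
rewrite mxE eps_scale eps_mul eps_t eps_tstar ![_ == r]eq_sym.
by have [<-|_] := eqVneq r j; have [<-|_] := eqVneq r k;
  rewrite ?mulr0 ?mul0r ?mulr0 ?mulr1 ?mulfV.
Qed.

Lemma eps_Ki2_tstar (k : 'I_m.+1) :
  ev (act Ki (act Ki (star (t m r k)))) = w m k ^+ 2 * (r == k)%:R.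
Proof.
rewrite act_Ki_tstar (linear_scale (act_linear Ki)) act_Ki_tstar scalerA.
by rewrite eps_scale eps_tstar.
Qed.

Lemma dE_row_proj (j k : 'I_m.+1) : dE (row_proj j k) = w m j / w m k *
  (w m j ^+ 2 * (r == j)%:R * ((r == k.+1 :> nat)%:R * (a k / w m r))
   - q%:C * ((r.+1 == j :> nat)%:R * (a r * w m r)) * (r == k)%:R).
Proof.
by rewrite mxE dE_scale dE_mul dE_tstar eps_t dE_t eps_Ki2_tstar addrC mulNr.
Qed.

Lemma dF_row_proj (j k : 'I_m.+1) : dF (row_proj j k) = w m j / w m k *
  (w m j ^+ 2 * (r == j)%:R * ((r.+1 == k :> nat)%:R * (a r / w m r))
   - q^-1%:C * ((r == j.+1 :> nat)%:R * (a j * w m r)) * (r == k)%:R).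
Proof.
by rewrite mxE dF_scale dF_mul dF_tstar eps_t dF_t eps_Ki2_tstar addrC mulNr.
Qed.

(* the summand of the weighted trace of q dE(P) dF(P) *)
Let g (j k : 'I_m.+1) :=
  (w m j ^- 2) * (q%:C * (dE (row_proj j k) * dF (row_proj k j))).

Let qCV : q^-1%:C = (q%:C)^-1 :> R[i]. Proof. exact: fmorphV. Qed.

Let g_row k : g r k = - (r == k.+1 :> nat)%:R * a k ^+ 2.
Proof.
rewrite /g dE_row_proj dF_row_proj eqxx [r.+1 == r]gtn_eqF // qCV.
have [rk|_] := eqVneq (r : nat) k.+1.
  have -> : (r == k) = false by rewrite -(inj_eq val_inj) /= rk gtn_eqF.
  by rewrite /=; field; rewrite !w_neq0 qC_neq0.
by rewrite /=; field; rewrite !w_neq0 qC_neq0.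
Qed.

Let g_off j k : j != r ->
  g j k = - ((r.+1 == j :> nat) && (k == r))%:R * a r ^+ 2.
Proof.
move=> jr; rewrite /g dE_row_proj dF_row_proj [r == j]eq_sym (negPf jr) qCV.
have [<-|_] := eqVneq r k; last first.
  by rewrite andbF /=; field; rewrite !w_neq0 qC_neq0.
have [rj|_] := eqVneq r.+1 j; last first.
  by rewrite /=; field; rewrite !w_neq0 qC_neq0.
rewrite (w_succ (esym rj)) /= [r == r.+1 :> nat]ltn_eqF //.
by field; rewrite !w_neq0 qC_neq0.
Qed.

Let sum_g_row : \sum_k g r k = - (qint q r * qint q (m%:Z - r%:Z + 1))%:C.
Proof.
under eq_bigr do rewrite g_row mulNr.
rewrite sumrN; congr (- _); case r_eq: (r : nat) => [|k].
  by rewrite big1 => [|i _]; rewrite /= ?mul0r // /qint oppr0 subrr !mul0r.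
have km : (k < m.+1)%N by have := ltn_ord r; rewrite r_eq => /ltnW.
rewrite (bigD1 (Ordinal km)) //= eqxx mul1r big1 ?addr0 => [|i]; last first.
  rewrite -(inj_eq val_inj) /= => ik.
  by rewrite eqSS eq_sym (negPf ik) mul0r.
rewrite -(rmorphXn (real_complex R)) /= alpha_sqr //; congr (_%:C).
rewrite mulrC; congr (_ * qint q _).
by rewrite -addn1 PoszD opprD addrA subrK.
Qed.

Let sum_g_off : \sum_(j | j != r) \sum_k g j k =
  - (qint q (m%:Z - r%:Z) * qint q (r%:Z + 1))%:C.
Proof.
have r_le : (r <= m)%N by rewrite -ltnS.
rewrite -PoszD addn1 -(alpha_sqr q_gt0) // (rmorphXn (real_complex R)) /=.
transitivity (\sum_(j | j != r) - ((r.+1 == j :> nat)%:R * a r ^+ 2)).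
  apply: eq_bigr => j jr; rewrite (bigD1 r) //= big1 ?addr0 => [|k kr].
    by rewrite g_off // eqxx andbT mulNr.
  by rewrite g_off // (negPf kr) andbF oppr0 mul0r.
rewrite sumrN -mulr_suml; congr (- _); have [rm|mr] := ltnP r m.
  have r1m : (r.+1 < m.+1)%N by [].
  rewrite (bigD1 (Ordinal r1m)) /= ?eqxx; last first.
    by rewrite -(inj_eq val_inj) /= gtn_eqF.
  rewrite big1 ?addr0 ?mul1r // => j /andP[_].
  by rewrite -(inj_eq val_inj) /= eq_sym => /negPf ->.
have -> : a r = 0.
  have -> : (r : nat) = m by apply/eqP; rewrite eqn_leq r_le.
  by rewrite /alpha subrr /qint oppr0 subrr !mul0r sqrtr0.
by rewrite expr0n mulr0.
Qed.

(** In [trace_phi], varphi(1, P, P) sums all of g, while in varphi(P, P, P) the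
    matrix unit eps(P) keeps the row r of g only. What remains is an instance
    of [qint_mulB]. *)
Lemma trace_phi_row_proj :
  - 2%:R * \sum_(i < m.+1) \sum_j \sum_k w m i ^- 2 *
      phi (row_proj i j) (row_proj j k) (row_proj k i)
  = (qint q (wt2 m r))%:C.
Proof.
have [c zE] := row_proj_trace.
rewrite (@trace_phi _ row_proj (fun i => w m i ^- 2) c row_proj_sphere
  row_proj_idem row_proj_theta zE).
have -> :
    \sum_(i < m.+1) \sum_j
      w m i ^- 2 * varphi act 1 (row_proj i j) (row_proj j i) =
    \sum_i \sum_j g i j.
  apply: eq_bigr => i _; apply: eq_bigr => j _.
  by rewrite varphiE [eps A 1]rmorph1 mul1r.
have -> : \sum_(i < m.+1) \sum_j \sum_k w m i ^- 2 *
    varphi act (row_proj i j) (row_proj j k) (row_proj k i) = \sum_k g r k.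
  rewrite (bigD1 r) //= [X in _ + X]big1 ?addr0 => [|i ir]; last first.
    rewrite big1 // => j _; rewrite big1 // => k _.
    by rewrite varphiE eps_row_proj (negPf ir) !mul0r !mulr0.
  rewrite (bigD1 r) //= [X in _ + X]big1 ?addr0 => [|j jr]; last first.
    rewrite big1 // => k _.
    by rewrite varphiE eps_row_proj (negPf jr) mulr0 !mul0r !mulr0.
  by apply: eq_bigr => k _; rewrite varphiE eps_row_proj eqxx !mul1r.
rewrite (bigD1 r) //= sum_g_off sum_g_row.
have wt2E : wt2 m r = r%:Z - (m%:Z - r%:Z).
  by rewrite /wt2 mul2n -addnn PoszD opprB addrA.
rewrite wt2E -[in RHS]qint_mulB // (rmorphB (real_complex R)) /=.
by ring.
Qed.

End Row.

(** * The projections P_N *)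

Variable sigma : forall m : nat, U -> 'M[R[i]]_m.+1.
Hypothesis sigmaP : sigma_spec t act sigma.

(** Applying eps to the defining equation in row j singles out the coefficient
    of v_jj. *)
Lemma sigma_diag m f (d : 'I_m.+1 -> R[i]) :
  (forall n k, act f (t m n k) = d k *: t m n k) ->
  forall j k, sigma m f j k = (j == k)%:R * d k.
Proof.
move=> fd j k; apply: (mulfI (v_neq0 j)).
have := congr1 (eps A) (sigmaP f j k).
rewrite /vpw (linear_scale (act_linear f)) fd !eps_scale eps_t eps_sum.
rewrite (bigD1 j) //= big1 ?addr0 => [|i ij]; last first.
  by rewrite !eps_scale eps_t eq_sym (negPf ij) !mulr0.
rewrite !eps_scale eps_t eqxx mulr1 => svE; rewrite [LHS]mulrC -svE.
by rewrite [d k * _]mulrC.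
Qed.

Let US_Ki : US U Ki = K.
Proof.
have [SK _ _] := US_gen U; have := US_mul K Ki.
rewrite KKi US_one SK => /esym SKi.
by rewrite -[LHS]mulr1 -KiK mulrA SKi mul1r.
Qed.

(** On powers of K the twisting by K in rho^o is trivial, and S inverts. *)
Lemma rho_circ_Ki m j k : rho_circ sigma m Ki j k = (j == k)%:R * w m k.
Proof.
apply: (@sigma_diag m _ (fun k => w m k)) => n i.
by rewrite US_Ki KiK mul1r act_K_t.
Qed.

Lemma rho_circ_K m j k : rho_circ sigma m K j k = (j == k)%:R * (w m k)^-1.
Proof.
have [SK _ _] := US_gen U.
apply: (@sigma_diag m _ (fun k => (w m k)^-1)) => n i.
by rewrite SK -mulrA KiK mulr1 act_Ki_t.
Qed.

Lemma rho_circ_K2 m j k :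
  rho_circ sigma m (K ^+ 2) j k = (j == k)%:R * w m k ^- 2.
Proof.
have [SK _ _] := US_gen U.
apply: (@sigma_diag m _ (fun k => w m k ^- 2)) => n i.
rewrite expr2 US_mul SK -!mulrA KiK mulr1 act_mul act_Ki_t.
by rewrite (linear_scale (act_linear Ki)) act_Ki_t scalerA -invfM.
Qed.

Lemma podles_projE N : podles_proj t sigma N = row_proj (row_index N).
Proof.
apply/matrixP => j k; rewrite mxE.
rewrite (bigD1 k) //= big1 ?addr0 => [|i ik]; last first.
  by rewrite !mxE rho_circ_K (negPf ik) mul0r scale0r mulr0.
rewrite mxE big_ord1 mxE (bigD1 j) //= big1 ?addr0 => [|i ij]; last first.
  by rewrite !mxE rho_circ_Ki eq_sym (negPf ij) mul0r scale0r mul0r.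
rewrite !mxE rho_circ_K rho_circ_Ki !eqxx !mul1r.
by rewrite -!scalerAl mul1r -scalerAr mulr1 scalerA mulrC.
Qed.

Lemma pairing_diag m (psi : A -> A -> A -> R[i]) (P : 'M[A]_m.+1) :
  pairing sigma psi P =
  - 2%:R * \sum_(i < m.+1) \sum_j \sum_k
    w m i ^- 2 * psi (P i j) (P j k) (P k i).
Proof.
congr (_ * _); apply: eq_bigr => i _; apply: eq_bigr => j _.
apply: eq_bigr => k _; rewrite (bigD1 i) //= big1 ?addr0 => [|l li].
  by rewrite rho_circ_K2 eqxx mul1r.
by rewrite rho_circ_K2 (negPf li) !mul0r.
Qed.

Lemma pairing_podles_proj N :
  pairing sigma phi (podles_proj t sigma N) = (qint q N)%:C.
Proof.
rewrite podles_projE pairing_diag trace_phi_row_proj; congr (qint q _)%:C.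
rewrite /wt2 /row_index; case: ifP => [N0|/negbT N0] /=; lia.
Qed.

End Pairing.

Theorem proposition5p5 (R : realType) (q : R) (q_gt0 : 0 < q) (q_neq1 : q != 1)
  (U : Uq_su2 q) (A : O_SUq2 q)
  (t : forall m : nat, 'M[A]_m.+1) (t_pw : peter_weyl t)
  (act : U -> A -> A) (act_left : left_action t act)
  (del : U -> A -> A) (del_comm : commuting_action t act del)
  (sigma : forall m : nat, U -> 'M[R[i]]_m.+1)
  (sigmaP : sigma_spec t act sigma)
  (chi : A -> A -> R[i]) (chi_bilin : bilinear_on del chi)
  (chi_phi : forall a1 a2 : A, a1 \in podles del -> a2 \in podles del ->
     phi_of act chi 1 a1 a2 = 0) :
  twisted_cyclic_2cocycle act del (phi_of act chi) /\
  forall N : int,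
    pairing sigma (phi_of act chi) (podles_proj t sigma N) = (qint q N)%:C.
Proof.
split=> [|N].
  exact (phi_cocycle q_gt0 q_neq1 t_pw act_left del_comm chi_bilin chi_phi).
exact (pairing_podles_proj q_gt0 q_neq1 t_pw act_left del_comm chi_bilin
  chi_phi sigmaP N).
Qed.
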